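(* Let $I$ be a compact interval. For every Borel probability measure $\mu$ on $I$, there is no $\mu$-expansive homeomorphism $f: I\to I$.
   Context: For a homeomorphism $f$ of a metric space $(X,d)$, $x\in X$ and $\delta>0$, put $\Gamma_\delta(x)=\{y\in X: d(f^i(x),f^i(y))\leq\delta \text{ for all } i\in\mathbb{Z}\}$. Given a Borel probability measure $\mu$ on $X$, $f$ is called $\mu$-expansive if there is $\delta>0$ such that $\mu(\Gamma_\delta(x))=0$ for all $x\in X$. The interval $I\subset\mathbb{R}$ carries its usual metric. *)

(* Defs.v *)
From HB Require Import structures.
From mathcomp Require Import all_boot all_order all_algebra.
From mathcomp Require Import all_classical all_reals all_analysis.

Set Implicit Arguments.
Unset Strict Implicit.
Unset Printing Implicit Defensive.

Import Order.TTheory GRing.Theory Num.Theory.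
Import numFieldTopology.Exports.

Local Open Scope classical_set_scope.
Local Open Scope ring_scope.

Section subset_metric.
Context {R : realType} {X : metricType R} (A : set X).

Let dist (x y : A) : R := mdist (set_val x) (set_val y).

Let dist_ge0 x y : 0 <= dist x y.
Proof. exact: mdist_ge0. Qed.

Let dist_positivity x y : dist x y = 0 -> x = y.
Proof. by move/mdist_positivity; rewrite set_valE => /val_inj. Qed.

Let ballEdist (x : A) (r : R) : ball x r = [set y | dist x y < r].
Proof.
by apply/seteqP; split => y; rewrite /ball/= /initial_ball ballEmdist.
Qed.

HB.instance Definition _ :=
  PseudoMetric_isMetric.Build R (set_type A) dist_ge0 dist_positivity ballEdist.

End subset_metric.

Record homeomorphism (X : topologicalType) := Homeomorphism {
  homeo_fun :> X -> X;
  homeo_inv : X -> X;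
  homeo_funK : cancel homeo_fun homeo_inv;
  homeo_invK : cancel homeo_inv homeo_fun;
  homeo_continuous : continuous homeo_fun;
  homeo_inv_continuous : continuous homeo_inv }.

(* [Negz n] is the integer [- n.+1]. *)
Definition homeo_iter (X : topologicalType) (f : homeomorphism X) (i : int) :
    X -> X :=
  match i with
  | Posz n => iter n f
  | Negz n => iter n.+1 (homeo_inv f)
  end.

Definition Gamma (R : realType) (X : metricType R) (f : homeomorphism X)
    (delta : R) (x : X) : set X :=
  [set y | forall i : int, mdist (homeo_iter f i x) (homeo_iter f i y) <= delta].

(* The library's measurable types are pointed, hence so are the spaces below. *)
#[short(type="pmetricType")]
HB.structure Definition PointedMetric (K : numDomainType) :=
  { M of Metric K M & Pointed M }.

Notation borel X := (g_sigma_algebraType (@open X)).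

Definition measure_expansive (R : realType) (X : pmetricType R)
    (mu : probability (borel X) R) (f : homeomorphism X) : Prop :=
  exists2 delta : R, 0 < delta & forall x : X, mu (Gamma f delta x) = 0%E.

(* The segment [a, b] with the distance of [R], which the library attaches to
   the alias [R^o]. The proof [ab] provides the base point [a]. *)
Definition segment (R : realType) (a b : R) (ab : a <= b) : Type :=
  set_type (`[a, b]%classic : set R^o).

Section segment_instances.
Context {R : realType} {a b : R} (ab : a <= b).

Let a_in_segment : a \in (`[a, b]%classic : set R^o).
Proof. by rewrite inE /= in_itv /= lexx ab. Qed.

HB.instance Definition _ := Metric.copy (segment ab)
  (set_type (`[a, b]%classic : set R^o)).
HB.instance Definition _ :=
  isPointed.Build (segment ab) (exist _ a a_in_segment).

End segment_instances.

(* Main.v *)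
Require Import Defs.
From mathcomp Require Import all_boot all_order all_algebra.
From mathcomp Require Import all_classical all_reals all_analysis.
From mathcomp Require Import lra.

(** If all the sets Gamma_delta(x) of a homeomorphism f were null, then every
    point of the segment would have a null neighbourhood, hence so would the
    whole segment, by second countability; that contradicts total mass 1.

    Homeomorphisms of a segment are strictly monotone, so f preserves
    betweenness and f^2 is increasing, whether or not f reverses orientation.
    This has two consequences.
    - A point x not fixed by f^2 is an interior point of Gamma_delta(x)
      ([Gamma_nbhs]): the orbits of f^2 are bounded monotone sequences, so the
      image under f^n of the interval from f^-2(x) to f^2(x) has length at
      most delta once |n| is large ([orbit_gap]), and continuity of the
      remaining finitely many iterates cuts out a neighbourhood of x. So x has
      a null neighbourhood.
    - If x and q are fixed by f^2, with q close to x and f(q) close to f(x),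
      then the whole interval from x to q lies in Gamma_delta(x)
      ([Gamma_periodic_pair]), since each of its iterates is the
      interval from x to q or the one from f(x) to f(q).

    A point x fixed by f^2 need not be interior to Gamma_delta(x), but each of
    its two sides is null near x: either it contains a nearby q fixed by f^2,
    or it consists, near x, of points not fixed by f^2, all of which have null
    neighbourhoods ([negligible_locally] adds these up). As {x} itself lies in
    Gamma_delta(x), the point x has a null neighbourhood as well. *)

Import Order.TTheory GRing.Theory Num.Theory.
Import numFieldTopology.Exports.
Set Implicit Arguments.
Unset Strict Implicit.
Unset Printing Implicit Defensive.

Local Open Scope classical_set_scope.
Local Open Scope ring_scope.

(** * Monotonicity of homeomorphisms of a segment *)

Section segment_homeomorphisms.
Context {R : realType} {a b : R} {ab : a <= b}.
Local Notation X := (segment ab).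
Implicit Types (x y z p q w : X) (f : homeomorphism X).

Definition coord x : R := set_val x.

Lemma coord_inj : injective coord.
Proof. by move=> x y; rewrite /coord set_valE => /val_inj. Qed.

Lemma coord_continuous : continuous coord.
Proof. exact: initial_continuous. Qed.

Lemma coord_itv x : a <= coord x <= b.
Proof. by have := set_valP x; rewrite /= in_itv. Qed.

Lemma mdist_coord x y : mdist x y = `|coord y - coord x|.
Proof. by []. Qed.

(** The result for injective continuous functions on a real interval, carried
    over to the subtype of points of the segment. *)
Lemma homeo_strict_mono f :
  (forall x y, coord x < coord y -> coord (f x) < coord (f y)) \/
  (forall x y, coord x < coord y -> coord (f y) < coord (f x)).
Proof.
(* Points outside the segment are sent to the base point before f applies. *)
pose F (t : R) : R := coord (f (insubd (point : X) t)).
have FE x : F (coord x) = coord (f x).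
  by rewrite /F /coord set_valE valKd.
have liftX t : t \in `[a, b] -> exists x : X, coord x = t.
  move=> tab; have tab' : t \in (`[a, b]%classic : set R^o) by rewrite inE.
  by exists (exist _ t tab'); rewrite /coord set_valE.
have coordX x : coord x \in `[a, b] by rewrite in_itv /= coord_itv.
have Fcont : {within `[a, b]%classic, continuous F}.
  apply/subspace_sigL_continuousP.
  have -> : sigL `[a, b]%classic F = coord \o f.
    by apply/funext => x; rewrite /sigL /= -FE.
  move=> x; apply: continuous_comp; first exact: homeo_continuous.
  exact: coord_continuous.
have Finj : {in `[a, b] &, injective F}.
  move=> s t /liftX[x <-] /liftX[y <-]; rewrite !FE => /coord_inj.
  by move=> /(can_inj (homeo_funK f)) ->.
have [Fmono|Fmono] := itv_continuous_inj_mono Fcont Finj.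
- by left => x y xy; rewrite -!FE; exact: Fmono.
- by right => x y xy; rewrite -!FE; exact: Fmono.
Qed.

(** Symmetric in the endpoints, so that orientation-reversing maps preserve it
    too. *)
Definition between p y q :=
  coord p <= coord y <= coord q \/ coord q <= coord y <= coord p.

Lemma between_homeo f p y q : between p y q -> between (f p) (f y) (f q).
Proof.
rewrite /between; have [fmono|fmono] := homeo_strict_mono f.
- have fle u v : coord u <= coord v -> coord (f u) <= coord (f v).
    by rewrite le_eqVlt => /orP[/eqP/coord_inj->//|/fmono/ltW].
  by move=> [|] /andP[py yq]; [left|right]; rewrite !fle.
- have fle u v : coord u <= coord v -> coord (f v) <= coord (f u).
    by rewrite le_eqVlt => /orP[/eqP/coord_inj->//|/fmono/ltW].
  by move=> [|] /andP[py yq]; [right|left]; rewrite !fle.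
Qed.

Lemma between_iter f n p y q :
  between p y q -> between (iter n f p) (iter n f y) (iter n f q).
Proof. by elim: n => //= n IHn /IHn; exact: between_homeo. Qed.

Lemma between_mdist p y z q :
  between p y q -> between p z q -> mdist y z <= mdist p q.
Proof.
rewrite !mdist_coord /between ler_norml => pyq pzq.
have := ler_norm (coord q - coord p); have := ler_norm (coord p - coord q).
rewrite [X in _ <= X -> _]distrC; move: pyq pzq; lra.
Qed.

Lemma homeo_square_homo f x y :
  coord x <= coord y -> coord (f (f x)) <= coord (f (f y)).
Proof.
rewrite le_eqVlt => /orP[/eqP/coord_inj->//|].
by have [fmono|fmono] := homeo_strict_mono f => /fmono/fmono/ltW.
Qed.

(** Negative iterates of f are positive iterates of its inverse, which reduces
    statements on two-sided orbits to statements on forward ones. *)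
Definition homeo_inverse f : homeomorphism X :=
  Homeomorphism (@homeo_invK _ f) (@homeo_funK _ f)
    (@homeo_inv_continuous _ f) (@homeo_continuous _ f).

Lemma homeo_iter_continuous f n : continuous (iter n f : X -> X).
Proof.
elim: n => [|n IHn] x /=; first exact: cvg_id.
apply: (@continuous_comp _ _ _ (iter n f) f); first exact: IHn.
exact: homeo_continuous.
Qed.

(** * Orbits of the square *)

(** The orbit of w under the increasing map f^2 is a monotone sequence in a
    bounded set, so it converges and its consecutive differences vanish. *)
Lemma square_orbit_gap f w (d : R) : 0 < d ->
  \forall n \near \oo,
    mdist (iter n (f \o f) w) (iter n (f \o f) (f (f w))) <= d.
Proof.
move=> d0; pose u n := coord (iter n (f \o f) w).
have step x y m : coord x <= coord y ->
    coord (iter m (f \o f) x) <= coord (iter m (f \o f) y).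
  by elim: m => //= m IHm /IHm; exact: homeo_square_homo.
have uS n : u n.+1 = coord (iter n (f \o f) (f (f w))) by rewrite /u iterSr.
have cvg_u : cvgn u.
  have [le_w|/ltW ge_w] := lerP (coord w) (coord (f (f w))).
  - apply: nondecreasing_is_cvgn.
      by apply/nondecreasing_seqP => n; rewrite uS step.
    by exists b => _ [n _ <-]; have /andP[] := coord_itv (iter n (f \o f) w).
  - apply: nonincreasing_is_cvgn.
      by apply/nonincreasing_seqP => n; rewrite uS step.
    by exists a => _ [n _ <-]; have /andP[] := coord_itv (iter n (f \o f) w).
have cvg_gap : (fun n => u n.+1 - u n) @ \oo --> (0 : R).
  rewrite -(subrr (limn u)); apply: cvgB => //.
  by rewrite -[X in X @ _](_ : (fun n => u (n + 1)%N) = _) ?cvg_shiftn//;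
    apply/funext => n; rewrite addn1.
have /cvgrPdist_le/(_ d d0) := cvg_gap.
by apply: filterS => n; rewrite sub0r normrN uS.
Qed.

Lemma iter_square f n x : iter n (f \o f) x = iter n.*2 f x.
Proof. by elim: n => //= n ->. Qed.

(** The iterate f^n maps the interval between w and f^2(w) into the one
    between f^n(w) and f^n(f^2(w)). For n even or odd, the latter is spanned
    by two consecutive points of the f^2-orbit of w or of f(w). *)
Lemma orbit_gap f w (d : R) : 0 < d ->
  exists N : nat, forall n y z, (N <= n)%N ->
    between w y (f (f w)) -> between w z (f (f w)) ->
    mdist (iter n f y) (iter n f z) <= d.
Proof.
move=> d0; have [N _ Ngap] := filterI (square_orbit_gap f w d0)
  (square_orbit_gap f (f w) d0).
(* The bound guarantees N <= n./2, whatever the parity of n. *)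
exists N.*2.+1 => n y z Nn wy wz.
apply: le_trans (between_mdist (between_iter f n wy) (between_iter f n wz)) _.
have Nn2 : (N <= n./2)%N by rewrite -(half_bit_double N true) half_leq.
have [+ +] := Ngap _ Nn2.
have := odd_double_half n; rewrite !iter_square.
move: (n./2) => k; case: (odd n) => <-; first by rewrite add1n !iterSr => _.
by rewrite add0n.
Qed.

(** * Points close to the orbit of a given point *)

Lemma near_finite_orbit f x N (d : R) : 0 < d ->
  \forall y \near x, forall n, (n < N)%N ->
    mdist (iter n f x) (iter n f y) <= d.
Proof.
move=> d0; elim: N => [|N IHN].
  by apply: (nearW (F := nbhs x)) => y n; rewrite ltn0.
have near_ball : \forall y \near x, ball (iter N f x) d (iter N f y).
  have cont_iter : {for x, continuous (iter N f : X -> X)}.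
    exact: homeo_iter_continuous.
  apply: cont_iter.
  exact: nbhsx_ballx.
apply: filterS2 IHN near_ball => y IHy; rewrite ballEmdist /= => /ltW dN n.
by rewrite ltnS leq_eqVlt => /orP[/eqP->//|]; exact: IHy.
Qed.

(** Continuity controls the first iterates and [orbit_gap] the later ones. The
    point x will be an endpoint of the interval between w and f^2(w), so this
    lemma controls one side of x at a time. *)
Lemma near_forward_orbit f x w (d : R) : 0 < d ->
  between w x (f (f w)) ->
  \forall y \near x, between w y (f (f w)) ->
    forall n, mdist (iter n f x) (iter n f y) <= d.
Proof.
move=> d0 wx; have [N gapN] := orbit_gap f w d0.
near=> y => wy n; have [nN|Nn] := ltnP n N; last exact: gapN.
by move: n nN; near: y; exact: near_finite_orbit.
Unshelve. all: by end_near. Qed.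

Lemma GammaP f (d : R) x y :
  (forall n, mdist (iter n f x) (iter n f y) <= d) ->
  (forall n, mdist (iter n (homeo_inverse f) x)
                   (iter n (homeo_inverse f) y) <= d) ->
  Gamma f d x y.
Proof. by move=> fwd bwd [n|n]; [exact: fwd|exact: bwd n.+1]. Qed.

Lemma between_sym p y q : between p y q -> between q y p.
Proof. by case; [right|left]. Qed.

Lemma between_endl p q : between p p q.
Proof. by rewrite /between !lexx /= andbT; apply/orP; exact: le_total. Qed.

Lemma between_endr p q : between p q q.
Proof. exact/between_sym/between_endl. Qed.

(** Since f^2 moves x, the interval between f^-2(x) and f^2(x) has x in its
    interior. On each of its two halves, [near_forward_orbit] applies to f and
    to the inverse of f. *)
Lemma Gamma_nbhs f x (d : R) : 0 < d -> f (f x) <> x ->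
  nbhs x (Gamma f d x).
Proof.
move=> d0 ffx; pose g := homeo_inverse f.
have fg z : f (g z) = z by exact: homeo_invK.
have gf z : g (f z) = z by exact: homeo_funK.
have half z : f (f (g (g z))) = z by rewrite !fg.
have half' z : g (g (f (f z))) = z by rewrite !gf.
have fwdr : \forall y \near x, between x y (f (f x)) ->
    forall n, mdist (iter n f x) (iter n f y) <= d.
  exact/near_forward_orbit/between_endl.
have fwdl : \forall y \near x, between (g (g x)) y x ->
    forall n, mdist (iter n f x) (iter n f y) <= d.
  have := @near_forward_orbit f x (g (g x)) d d0; rewrite half; apply.
  exact: between_endr.
have bwdl : \forall y \near x, between x y (g (g x)) ->
    forall n, mdist (iter n g x) (iter n g y) <= d.
  exact/near_forward_orbit/between_endl.
have bwdr : \forall y \near x, between (f (f x)) y x ->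
    forall n, mdist (iter n g x) (iter n g y) <= d.
  have := @near_forward_orbit g x (f (f x)) d d0; rewrite half'; apply.
  exact: between_endr.
have sides : \forall y \near x,
    between (g (g x)) y x \/ between x y (f (f x)).
  have cvgx : coord y @[y --> x] --> coord x by exact: coord_continuous.
  have : coord (f (f x)) != coord x by apply/eqP => /coord_inj.
  rewrite neq_lt => /orP[xffx|ffxx].
  - have xggx : coord x < coord (g (g x)).
      rewrite ltNge; apply/negP => /(homeo_square_homo f).
      by rewrite half leNgt xffx.
    near=> y.
    have y1 : coord (f (f x)) < coord y by near: y; exact: cvgr_gt cvgx _ _.
    have y2 : coord y < coord (g (g x)) by near: y; exact: cvgr_lt cvgx _ _.
    by rewrite /between; move: y1 y2; case: (leP (coord x) (coord y)); lra.
  - have ggxx : coord (g (g x)) < coord x.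
      rewrite ltNge; apply/negP => /(homeo_square_homo f).
      by rewrite half leNgt ffxx.
    near=> y.
    have y1 : coord y < coord (f (f x)) by near: y; exact: cvgr_lt cvgx _ _.
    have y2 : coord (g (g x)) < coord y by near: y; exact: cvgr_gt cvgx _ _.
    by rewrite /between; move: y1 y2; case: (leP (coord x) (coord y)); lra.
near=> y.
have [yl|yr] : between (g (g x)) y x \/ between x y (f (f x)) by near: y.
- apply: GammaP; first by move: yl; near: y.
  by move: (between_sym yl); near: y.
- apply: GammaP; first by move: yr; near: y.
  by move: (between_sym yr); near: y.
Unshelve. all: by end_near. Qed.

Lemma periodic_pair_forward f x q y (d : R) :
  f (f x) = x -> f (f q) = q ->
  mdist x q <= d -> mdist (f x) (f q) <= d -> between x y q ->
  forall n, mdist (iter n f x) (iter n f y) <= d.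
Proof.
move=> ffx ffq xq fxq xyq n.
have xyqn := between_iter f n xyq.
apply: le_trans (between_mdist (between_endl _ _) xyqn) _.
(* Replacing (x, q) by (f x, f q) swaps the two distance bounds. *)
move: ffx ffq xq fxq; clear xyq xyqn.
elim: n x q => //= n IHn x q ffx ffq xq fxq.
by rewrite -!iterS !iterSr; apply: IHn; rewrite ?ffx ?ffq.
Qed.

(** On points fixed by f^2 the inverse of f agrees with f, so the hypotheses
    pass from f to its inverse and bound the backward orbits too. *)
Lemma Gamma_periodic_pair f x q y (d : R) :
  f (f x) = x -> f (f q) = q ->
  mdist x q <= d -> mdist (f x) (f q) <= d -> between x y q ->
  Gamma f d x y.
Proof.
move=> ffx ffq xq fxq xyq.
have inv z : f (f z) = z -> homeo_inverse f z = f z.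
  by move=> {1}<-; exact: homeo_funK.
have invinv z : f (f z) = z -> homeo_inverse f (homeo_inverse f z) = z.
  by move=> ffz; rewrite (inv z)//; exact: homeo_funK.
apply: GammaP; first exact: (@periodic_pair_forward _ _ q).
by apply: (@periodic_pair_forward _ _ q); rewrite ?invinv ?inv.
Qed.

Lemma Gamma_self f (d : R) x : 0 < d -> Gamma f d x x.
Proof. by move=> d0 i; rewrite mdistxx ltW. Qed.

Lemma Gamma_closed f (d : R) x : closed (Gamma f d x).
Proof.
have -> : Gamma f d x = \bigcap_(i in [set: int])
    [set y | mdist (homeo_iter f i x) (homeo_iter f i y) <= d].
  by apply/seteqP; split => y Gy i; [move=> _; exact: Gy|exact: (Gy i I)].
apply: closed_bigI => i _.
have iter_cont : continuous (homeo_iter f i : X -> X).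
  by case: i => n; [exact: (@homeo_iter_continuous f)|
                    exact: (@homeo_iter_continuous (homeo_inverse f))].
pose c := coord (homeo_iter f i x).
have dist_cont : continuous (fun r : R => `|r - c|).
  by move=> r; apply: cvg_norm; apply: cvgB; [exact: cvg_id|exact: cvg_cst].
rewrite (_ : [set y | _] =
  ((fun r : R => `|r - c|) \o coord \o homeo_iter f i) @^-1`
    [set r | r <= d])//.
apply: preimage_closed; last exact: closed_le.
move=> y _; apply: continuous_comp; first exact: iter_cont.
by apply: continuous_comp; [exact: coord_continuous|exact: dist_cont].
Qed.

(** * Null sets *)

Section null_sets.
Variable mu : probability (borel X) R.

Lemma Gamma_negligible f (d : R) x :
  mu (Gamma f d x) = 0%E -> mu.-negligible (Gamma f d x : set (borel X)).
Proof.
move=> mu0; exists (Gamma f d x); split => //.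
rewrite -[Gamma f d x]setCK; apply: (@measurableC _ (borel X)).
by apply: sub_sigma_algebra; rewrite openC; exact: Gamma_closed.
Qed.

(** Each such point lies in a null interval with rational endpoints, and there
    are only countably many of these. *)
Lemma negligible_locally :
  mu.-negligible ([set x | exists2 U : set X, nbhs x U &
    mu.-negligible (U : set (borel X))] : set (borel X)).
Proof.
pose J (r : rat * rat) : set X :=
  [set y | ratr r.1 < coord y < ratr r.2].
pose F (k : nat) : set (borel X) :=
  if unpickle k is Some r then
    if asbool (mu.-negligible (J r : set (borel X))) then J r else set0
  else set0.
have Fnull k : mu.-negligible (F k).
  rewrite /F; case: (unpickle k) => [r|]; last exact: negligible_set0.
  by case: asboolP => // _; exact: negligible_set0.
apply: negligibleS (negligible_bigcup Fnull) => x [U].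
rewrite -nbhs_ballE => -[e e0 eU] Unull.
have [ex xe] : coord x - e < coord x /\ coord x < coord x + e.
  by move: e0 => /= e0; split; lra.
have [r1] := rat_in_itvoo ex; have [r2] := rat_in_itvoo xe.
rewrite !in_itv /= => /andP[xr2 r2x] /andP[xr1 r1x].
have Jnull : mu.-negligible (J (r1, r2) : set (borel X)).
  apply: negligibleS Unull => y /= /andP[r1y yr2]; apply: eU.
  by rewrite ballEmdist /= mdist_coord ltr_norml; lra.
exists (pickle (r1, r2)); first exact: I.
by rewrite /F pickleK asboolT // /J /= r1x xr2.
Qed.

Variables (f : homeomorphism X) (d : R).
Hypotheses (d0 : 0 < d) (mu_Gamma : forall x, mu (Gamma f d x) = 0%E).

Let locally_null x :=
  exists2 U : set X, nbhs x U & mu.-negligible (U : set (borel X)).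

Let locally_null_nonperiodic x : f (f x) <> x -> locally_null x.
Proof.
move=> ffx; exists (Gamma f d x); first exact: Gamma_nbhs.
exact: Gamma_negligible.
Qed.

(** The right side of x for s = 1, the left side for s = -1. *)
Let side (s : R) x (e : R) : set X :=
  [set y | 0 < s * (coord y - coord x) < e].

(** A point q fixed by f^2 on that side and close to x traps the interval from
    x to q in Gamma f d x. Without such a q, that side consists near x of
    points not fixed by f^2. *)
Let side_negligible (s : R) x : s = 1 \/ s = - 1 -> f (f x) = x ->
  exists2 e : R, 0 < e & mu.-negligible (side s x e : set (borel X)).
Proof.
move=> s1 ffx.
(* The iterates 0 and 1 are the two that [Gamma_periodic_pair] asks to be
   close. *)
have /nbhs_ballP[e /= e0 eball] := near_finite_orbit f x 2 d0.
have [[q xqe ffq]|noq] := pselect (exists2 q, side s x e q & f (f q) = q).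
- have xq : ball x e q.
    rewrite ballEmdist /= mdist_coord ltr_norml; move: xqe; rewrite /side /=.
    by case: s1 => ->; lra.
  have xyG y : between x y q -> Gamma f d x y.
    apply: Gamma_periodic_pair => //.
      exact: (eball q xq 0%N).
    exact: (eball q xq 1%N).
  exists (s * (coord q - coord x)); first by have /andP[] := xqe.
  apply: negligibleS (Gamma_negligible (mu_Gamma x)) => y xy.
  apply: xyG; move: xy; rewrite /between /side /=.
  by case: s1 => ->; lra.
- exists e; first exact: e0.
  apply: negligibleS negligible_locally => y xy.
  by apply: locally_null_nonperiodic => ffy; apply: noq; exists y.
Qed.

Let locally_null_everywhere x : locally_null x.
Proof.
have [ffx|] := pselect (f (f x) = x); last exact: locally_null_nonperiodic.
have [er er0 rnull] := side_negligible (or_introl erefl) ffx.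
have [el el0 lnull] := side_negligible (or_intror erefl) ffx.
exists (ball x (Num.min er el)).
  by apply: nbhsx_ballx; rewrite lt_min er0.
have := negligibleU (Gamma_negligible (mu_Gamma x))
  (negligibleU rnull lnull).
apply: negligibleS => y; rewrite ballEmdist /= mdist_coord lt_min => /andP[].
rewrite !ltr_norml /side /=.
have [yx|xy|/coord_inj <-] := ltrgtP (coord y) (coord x).
- by move=> *; right; right; lra.
- by move=> *; right; left; lra.
- by move=> *; left; exact: Gamma_self.
Qed.

Lemma Gamma_not_all_null : False.
Proof.
have nullT : mu.-negligible [set: borel X].
  apply: negligibleS negligible_locally => x _.
  exact: locally_null_everywhere.
have /eqP := @probability_setT _ _ _ mu.
by rewrite (measure_negligible measurableT nullT) eq_sym onee_eq0.
Qed.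

End null_sets.
End segment_homeomorphisms.

Theorem theorem4p5 (R : realType) (a b : R) (ab : a <= b)
    (mu : probability (borel (segment ab)) R) :
  ~ exists f : homeomorphism (segment ab), measure_expansive mu f.
Proof.
move=> [f [d d0 mu0]].
exact: (Gamma_not_all_null d0 mu0).
Qed.
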